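(* Let ${\mathfrak D}\subset{\mathbb C}$ be a (bounded or unbounded) LMI region. If a real $n\times n$ matrix ${\mathbf A}$ is diagonally ${\mathfrak D}$-dominant, then ${\mathbf A}$ is ${\mathfrak D}$-stable, i.e. $\sigma({\mathbf A})\subset{\mathfrak D}$.
   Context: $\sigma({\mathbf A})$ is the set of eigenvalues of ${\mathbf A}$. An LMI region is a (nonempty) set ${\mathfrak D}=\{z\in{\mathbb C}: {\mathbf L}+z{\mathbf M}+\overline{z}{\mathbf M}^T\prec 0\}$ (negative definite), where ${\mathbf L},{\mathbf M}$ are real square matrices of the same size and ${\mathbf L}^T={\mathbf L}$. It is open, convex and symmetric about the real axis, and ${\mathfrak D}\cap{\mathbb R}=(\alpha,\beta)$ is a nonempty interval with possibly infinite endpoints. The function $r:(\alpha,\beta)\to{\mathbb R}^+$ of ${\mathfrak D}$: let $y(x)=\sup\{y: x+iy\in{\mathfrak D}\}$ for $x\in(\alpha,\beta)$ (the boundary curve of ${\mathfrak D}$ above the real axis), and $m(x)=\min(|x-\alpha|,|x-\beta|)$ (an infinite term is ignored if the other is finite). ''Bounded from above'' means $y(x)$ is finite. Case I: at least one of $\alpha,\beta$ is finite and ${\mathfrak D}$ is bounded from above: $r(x)=\dfrac{m(x)\,y(x)}{\sqrt{m(x)^2+y(x)^2}}$. Case II: $\alpha,\beta$ are both infinite (${\mathfrak D}$ is a horizontal stripe): $r(x)=y(x)=\mathrm{const}$. Case III: ${\mathfrak D}$ is unbounded from above ($y(x)=+\infty$; ${\mathfrak D}$ is a vertical stripe or half-plane):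 $r(x)=m(x)$. A real $n\times n$ matrix ${\mathbf A}=\{a_{ij}\}$ is diagonally ${\mathfrak D}$-dominant if $a_{ii}\in(\alpha,\beta)$ and $r(a_{ii})>\sum_{j\neq i}|a_{ij}|$ for all $i=1,\ldots,n$. *)

(* Defs.v *)
From HB Require Import structures.
From mathcomp Require Import all_boot all_order all_algebra.
From mathcomp Require Import all_classical all_reals ereal.
From mathcomp Require Import complex.

Set Implicit Arguments.
Unset Strict Implicit.
Unset Printing Implicit Defensive.

Import Order.TTheory GRing.Theory Num.Theory.

Local Open Scope classical_set_scope.
Local Open Scope ring_scope.
Local Open Scope complex_scope.
Local Open Scope sesquilinear_scope.

Definition complex_mx (R : realType) (p q : nat) (A : 'M[R]_(p, q)) :
  'M[R[i]]_(p, q) := map_mx (real_complex R) A.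

(* In the partial order of R[i], w < 0 says that w is real and negative. *)
Definition negative_definite (R : realType) (m : nat) (H : 'M[R[i]]_m) : Prop :=
  H \is hermsymmx /\
  forall v : 'cV[R[i]]_m, v != 0 -> (v ^t* *m H *m v) 0 0 < 0.

Definition lmi_set (R : realType) (m : nat) (L M : 'M[R]_m) : set R[i] :=
  [set z | negative_definite (complex_mx L + z *: complex_mx M
                              + Num.conj z *: complex_mx M^T)].

Definition lmi_region (R : realType) (D : set R[i]) : Prop :=
  D !=set0 /\
  exists (m : nat) (L M : 'M[R]_m), L^T = L /\ D = lmi_set L M.

Section Radius.
Variables (R : realType) (D : set R[i]).
Local Open Scope ereal_scope.

(* For an LMI region, the trace on the real axis is the open interval
   (lend, rend); the endpoints may be infinite. *)
Definition lend : \bar R := ereal_inf [set x%:E | x in [set x : R | D x%:C]].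
Definition rend : \bar R := ereal_sup [set x%:E | x in [set x : R | D x%:C]].

Definition boundary_curve (x : R) : \bar R :=
  ereal_sup [set y%:E | y in [set y : R | D (x +i* y)]].

(* An infinite endpoint is at distance +oo, hence is ignored by the minimum
   when the other endpoint is finite. *)
Definition end_dist (x : R) : \bar R :=
  Order.min `|x%:E - lend| `|x%:E - rend|.

(* Only meaningful for lend < x < rend.  The value is +oo exactly when D is the
   whole plane, which is an LMI region (take L negative definite and M = 0) and
   falls under the last branch; it is finite for all other LMI regions. *)
Definition radius (x : R) : \bar R :=
  let m := end_dist x in
  let y := boundary_curve x in
  if y \is a fin_num then
    if (lend \is a fin_num) || (rend \is a fin_num) then
      (fine m * fine y / Num.sqrt (fine m ^+ 2 + fine y ^+ 2))%:E
    else y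
  else m.

Definition diag_dominant (n : nat) (A : 'M[R]_n) : Prop :=
  forall i : 'I_n,
    [/\ lend < (A i i)%:E, (A i i)%:E < rend
      & ((\sum_(j < n | j != i) `|A i j|)%R)%:E < radius (A i i)].

End Radius.

Definition spectrum (R : realType) (n : nat) (A : 'M[R]_n) : set R[i] :=
  [set z | eigenvalue (complex_mx A) z].

Definition region_stable (R : realType) (D : set R[i]) (n : nat)
  (A : 'M[R]_n) : Prop := spectrum A `<=` D.

(* Main.v *)
Require Import Defs.
From mathcomp Require Import all_boot all_order all_algebra.
From mathcomp Require Import all_classical all_reals complex.
From mathcomp Require Import ereal ring lra.

(** By Gershgorin's theorem every eigenvalue of [A] lies in a closed disc
    centred at a diagonal entry [a = A i i], whose radius is the off-diagonal
    absolute row sum ([gershgorin]).  It remains to see that [D] contains every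
    closed disc centred at [a] of radius less than [radius D a]
    ([radius_disc_mem]).

    An LMI region is convex and symmetric about the real axis
    ([lmi_set_convex], [lmi_set_conj]): its defining matrix depends on [z] in a
    real-affine way, and conjugating [z] transposes it.  Convexity makes the
    real trace fill the whole interval between the two endpoints, and together
    with the symmetry it makes the vertical section at [a] contain every point
    whose distance to the real axis is less than [boundary_curve D a].  So [D]
    contains the open diagonals of the rhombus centred at [a] with
    half-diagonals [m = end_dist D a] and [y = boundary_curve D a], hence the
    open rhombus itself ([rhombus_mem]).

    If [m] and [y] are finite, [radius D a = m * y / sqrt (m ^ 2 + y ^ 2)] is
    the radius of the circle inscribed in that rhombus.  If only one of them is
    finite, the rhombus degenerates to a strip and [radius D a] is its
    half-width; if both are infinite, it is the whole plane.  In these cases the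
    given disc fits in a rhombus with sufficiently large finite
    half-diagonals. *)

Set Implicit Arguments.
Unset Strict Implicit.
Unset Printing Implicit Defensive.

Import Order.TTheory GRing.Theory Num.Theory.

Local Open Scope classical_set_scope.
Local Open Scope ring_scope.
Local Open Scope complex_scope.

(** * Convexity and symmetry of LMI regions *)

Definition convex_region (R : realType) (D : set R[i]) : Prop :=
  forall l a b c d : R, 0 < l -> l < 1 -> D (a +i* b) -> D (c +i* d) ->
  D ((l * a + (1 - l) * c) +i* (l * b + (1 - l) * d)).

Definition conj_invariant (R : realType) (D : set R[i]) : Prop :=
  forall a b : R, D (a +i* b) -> D (a -i* b).

Section HermitianForms.
Variables (C : numClosedFieldType) (m : nat).
Implicit Types (H K : 'M[C]_m) (v : 'cV[C]_m) (p q : C).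
Local Open Scope sesquilinear_scope.

Lemma hermsymmxP H :
  H \is hermsymmx <-> forall i j, H i j = Num.conj (H j i).
Proof.
rewrite is_hermitianmxE expr0 scale1r; split => [/eqP E i j|E].
  by rewrite {1}E !mxE.
by apply/eqP/matrixP => i j; rewrite !mxE.
Qed.

Lemma hermsymmx_comb H K p q : p \is Num.real -> q \is Num.real ->
  H \is hermsymmx -> K \is hermsymmx -> p *: H + q *: K \is hermsymmx.
Proof.
move=> /CrealP pR /CrealP qR /hermsymmxP hH /hermsymmxP hK.
apply/hermsymmxP => i j; rewrite !mxE rmorphD !rmorphM /= pR qR.
by rewrite -hH -hK.
Qed.

Lemma hermsymmx_tr H : H \is hermsymmx -> H^T \is hermsymmx.
Proof.
by move=> /hermsymmxP hH; apply/hermsymmxP => i j; rewrite 2![(_^T) _ _]mxE hH.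
Qed.

Lemma form_comb H K p q v :
  (v ^t* *m (p *: H + q *: K) *m v) 0 0 =
  p * (v ^t* *m H *m v) 0 0 + q * (v ^t* *m K *m v) 0 0.
Proof. by rewrite mulmxDr mulmxDl -!scalemxAr -!scalemxAl !mxE. Qed.

(** Transpose the scalar on the left. *)
Lemma form_tr H v :
  (v ^t* *m H^T *m v) 0 0 =
  ((map_mx Num.conj v) ^t* *m H *m map_mx Num.conj v) 0 0.
Proof.
have vE : (map_mx Num.conj v) ^t* = v^T.
  by apply/matrixP => i j; rewrite !mxE conjCK.
have wE : (map_mx Num.conj v) = (v ^t*)^T.
  by apply/matrixP => i j; rewrite !mxE.
have trE (X : 'M[C]_1) : X 0 0 = X^T 0 0 by rewrite mxE.
by rewrite vE wE [LHS]trE !trmx_mul trmxK mulmxA.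
Qed.

End HermitianForms.

Lemma negative_definite_comb (R : realType) (m : nat) (H K : 'M[R[i]]_m)
    (p q : R) : 0 < p -> 0 < q -> negative_definite H -> negative_definite K ->
  negative_definite (p%:C *: H + q%:C *: K).
Proof.
move=> p0 q0 [hH nH] [hK nK]; split.
  by apply: hermsymmx_comb => //; apply/complex_realP; eexists.
move=> v v0; rewrite form_comb -[X in _ < X]addr0.
by apply: ltrD; rewrite pmulr_rlt0 ?ltcR //; [exact: nH|exact: nK].
Qed.

Lemma negative_definite_tr (R : realType) (m : nat) (H : 'M[R[i]]_m) :
  negative_definite H -> negative_definite H^T.
Proof.
move=> [hH nH]; split; first exact: hermsymmx_tr.
move=> v v0; rewrite form_tr; apply: nH.
by rewrite map_mx_eq0.
Qed.

Definition lmi_mx (R : realType) (m : nat) (L M : 'M[R]_m) (z : R[i]) :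
  'M[R[i]]_m :=
  complex_mx L + z *: complex_mx M + Num.conj z *: complex_mx M^T.

Lemma lmi_mxE (R : realType) (m : nat) (L M : 'M[R]_m) (a b : R) i j :
  lmi_mx L M (a +i* b) i j =
  (L i j + a * (M i j + M j i)) +i* (b * (M i j - M j i)).
Proof.
rewrite /lmi_mx /complex_mx; do 8!rewrite mxE.
have -> : Num.conj (a +i* b) = a -i* b by [].
by simpc; congr (_ +i* _); ring.
Qed.

(** The defining matrix is real-affine in [z], so it commutes with convex
    combinations. *)
Lemma lmi_set_convex (R : realType) (m : nat) (L M : 'M[R]_m) :
  convex_region (lmi_set L M).
Proof.
move=> l a b c d l0 l1 Dz Dw; rewrite /lmi_set.
have l1' : 0 < 1 - l by rewrite subr_gt0.
change (negative_definite
  (lmi_mx L M ((l * a + (1 - l) * c) +i* (l * b + (1 - l) * d)))).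
have -> : lmi_mx L M ((l * a + (1 - l) * c) +i* (l * b + (1 - l) * d)) =
    l%:C *: lmi_mx L M (a +i* b) + (1 - l)%:C *: lmi_mx L M (c +i* d).
  apply/matrixP => i j.
  rewrite [LHS]lmi_mxE [RHS]mxE [X in _ = X + _]mxE [X in _ = _ + X]mxE.
  rewrite [X in _ = _ * X + _]lmi_mxE [X in _ = _ + _ * X]lmi_mxE; simpc.
  by congr (_ +i* _); ring.
exact: negative_definite_comb l0 l1' Dz Dw.
Qed.

(** As [L] is symmetric, conjugating [z] transposes the defining matrix. *)
Lemma lmi_set_conj (R : realType) (m : nat) (L M : 'M[R]_m) : L^T = L ->
  conj_invariant (lmi_set L M).
Proof.
move=> LT a b Dz.
change (negative_definite (lmi_mx L M (a -i* b))).
have -> : lmi_mx L M (a -i* b) = (lmi_mx L M (a +i* b))^T.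
  apply/matrixP => i j; rewrite [RHS]mxE [LHS]lmi_mxE [RHS]lmi_mxE.
  have -> : L j i = L i j by rewrite -[in LHS]LT mxE.
  by congr (_ +i* _); ring.
exact: negative_definite_tr Dz.
Qed.

(** * The rhombus inside a convex symmetric region *)

Lemma real_trace_mem (R : realType) (D : set R[i]) (x : R) :
  convex_region D -> (lend D < x%:E)%E -> (x%:E < rend D)%E -> D x%:C.
Proof.
move=> cD /ereal_inf_lt[_ [p /= Dp <-]]; rewrite lte_fin => px.
move=> /ereal_sup_gt[_ [q /= Dq <-]]; rewrite lte_fin => xq.
have pq : 0 < q - p by lra.
have l0 : 0 < (q - x) / (q - p) by apply: divr_gt0; lra.
have l1 : (q - x) / (q - p) < 1 by rewrite ltr_pdivrMr// mul1r; lra.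
have := cD _ _ _ _ _ l0 l1 Dp Dq; congr D; apply/eqP; rewrite eq_complex /=.
by apply/andP; split; apply/eqP; field; lra.
Qed.

(** A point of [D] above height [|t|] and its mirror image span a vertical
    segment through [x +i* t]. *)
Lemma vertical_mem (R : realType) (D : set R[i]) (x t : R) :
  convex_region D -> conj_invariant D ->
  (`|t|%:E < boundary_curve D x)%E -> D (x +i* t).
Proof.
move=> cD jD /ereal_sup_gt[_ [y /= Dy <-]]; rewrite lte_fin => ty.
have y0 : 0 < y by apply: le_lt_trans ty.
move: ty; rewrite ltr_norml => /andP[ty1 ty2].
have yy0 : 0 < y + y by lra.
have l0 : 0 < (y + t) / (y + y) by apply: divr_gt0; lra.
have l1 : (y + t) / (y + y) < 1 by rewrite ltr_pdivrMr// mul1r; lra.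
have := cD _ _ _ _ _ l0 l1 Dy (jD _ _ Dy); congr D.
apply/eqP; rewrite eq_complex /=.
by apply/andP; split; apply/eqP; field; lra.
Qed.

(** Every point of the open rhombus is a convex combination of a point of each
    open diagonal. *)
Lemma rhombus_mem (R : realType) (D : set R[i]) (a m y u v : R) :
  convex_region D -> 0 < m -> 0 < y ->
  (forall s, `|s| < m -> D (a + s)%:C) ->
  (forall t, `|t| < y -> D (a +i* t)) ->
  `|u| / m + `|v| / y < 1 -> D ((a + u) +i* v).
Proof.
move=> cD m0 y0 hs ht uv.
have pu : 0 <= `|u| / m by rewrite divr_ge0// ltW.
have pv : 0 <= `|v| / y by rewrite divr_ge0// ltW.
(* With weight l on the horizontal diagonal and 1 - l on the vertical one, the
   two points are a + u / l and a +i* (v / (1 - l)).  They lie on the open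
   diagonals iff |u| / m < l < 1 - |v| / y; l is the midpoint of that
   interval. *)
set l := (`|u| / m + 1 - `|v| / y) / 2.
have l0 : 0 < l by rewrite /l; lra.
have l1 : l < 1 by rewrite /l; lra.
have l1' : 0 < 1 - l by lra.
have ul : `|u| < l * m by rewrite -ltr_pdivrMr// /l; lra.
have vl : `|v| < (1 - l) * y by rewrite -ltr_pdivrMr// /l; lra.
have Ds : D (a + u / l)%:C.
  by apply: hs; rewrite normf_div (gtr0_norm l0) ltr_pdivrMr// mulrC.
have Dt : D (a +i* (v / (1 - l))).
  by apply: ht; rewrite normf_div (gtr0_norm l1') ltr_pdivrMr// mulrC.
have := cD l _ _ _ _ l0 l1 Ds Dt; congr D; apply/eqP; rewrite eq_complex /=.
by apply/andP; split; apply/eqP; field; lra.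
Qed.

(** Only a lower bound [m] of [end_dist D a] is fixed, so that an infinite
    distance to the endpoints is covered as well. *)
Lemma end_dist_mem (R : realType) (D : set R[i]) (a m s : R) :
  convex_region D -> (lend D < a%:E)%E -> (a%:E < rend D)%E ->
  (m%:E <= end_dist D a)%E -> `|s| < m -> D (a + s)%:C.
Proof.
move=> cD la ar; rewrite /end_dist le_min => /andP[ml mr] sm.
move: sm; rewrite ltr_norml => /andP[sm1 sm2].
apply: real_trace_mem => //.
- case: (lend D) la ml => [l| |] //=; rewrite ?ltNyr // !lte_fin lee_fin => la.
  by rewrite gtr0_norm ?subr_gt0//; lra.
- case: (rend D) ar mr => [r| |] //=; rewrite ?ltry // !lte_fin lee_fin => ar.
  by rewrite ltr0_norm ?subr_lt0//; lra.
Qed.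

(** * Gershgorin's theorem *)

(** [eigenvalue] speaks of row vectors, whereas row sums call for a column
    eigenvector; both exist because [A - z] and its transpose are singular
    together. *)
Lemma eigenvector_col (F : fieldType) (n : nat) (A : 'M[F]_n) (z : F) :
  eigenvalue A z -> exists2 x : 'cV[F]_n, A *m x = z *: x & x != 0.
Proof.
have -> : eigenvalue A z = eigenvalue A^T z.
  rewrite /eigenvalue /eigenspace !kermx_eq0 !row_free_unit -unitmx_tr.
  by rewrite linearB /= tr_scalar_mx.
case/eigenvalueP => v vA v0; exists v^T; last by rewrite trmx_eq0.
by rewrite -[LHS]trmxK trmx_mul trmxK vA linearZ.
Qed.

(** Take row [i] of the eigenvector equation [A x = z x], where [i] maximizes
    [|x i|]. *)
Lemma gershgorin (C : numFieldType) (n : nat) (A : 'M[C]_n) (z : C) :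
  eigenvalue A z ->
  exists i : 'I_n, `|z - A i i| <= \sum_(j < n | j != i) `|A i j|.
Proof.
move=> /eigenvector_col[x Ax /matrix0Pn[i0 [j0]]]; rewrite (ord1 j0) => xi0.
have [||i _ imax] := @comparable_arg_maxP _ _ _ i0 xpredT (fun i => `|x i 0|).
- by [].
(* The order of C is partial, but norms are real, hence comparable. *)
- by move=> i j _ _; apply: real_comparable; apply: normr_real.
have xi_gt0 : 0 < `|x i 0|.
  by apply: lt_le_trans (imax i0 isT); rewrite normr_gt0.
exists i; rewrite -(ler_pM2r xi_gt0) -normrM mulr_suml.
have -> : (z - A i i) * x i 0 = \sum_(j < n | j != i) A i j * x j 0.
  have := congr1 (fun X : 'cV_n => X i 0) Ax.
  rewrite !mxE (bigD1 i) //= mulrBl => <-; ring.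
apply: le_trans (ler_norm_sum _ _ _) _; apply: ler_sum => j _.
by rewrite normrM ler_wpM2l//; apply: imax.
Qed.

(** * Discs of radius less than the radius function *)

(** Cauchy-Schwarz for [(|u|, |v|)] and [(1 / m, 1 / y)]; the norm of the latter
    is the inverse of the inradius of the rhombus, so a disc of radius less than
    the inradius lies in the open rhombus. *)
Lemma rhombus_norm_le (R : rcfType) (u v m y : R) : 0 < m -> 0 < y ->
  `|u| / m + `|v| / y
    <= Num.sqrt (u ^+ 2 + v ^+ 2) / (m * y / Num.sqrt (m ^+ 2 + y ^+ 2)).
Proof.
move=> m0 y0.
have my0 : 0 < m ^+ 2 + y ^+ 2 by rewrite addr_gt0 ?exprn_gt0.
have s0 : 0 < Num.sqrt (m ^+ 2 + y ^+ 2) by rewrite sqrtr_gt0.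
have -> : `|u| / m + `|v| / y = (`|u| * y + `|v| * m) / (m * y).
  by field; rewrite !gt_eqF.
rewrite invf_div mulrA ler_pM2r ?invr_gt0 ?mulr_gt0//.
rewrite -sqrtrM ?addr_ge0 ?sqr_ge0//.
rewrite -[leLHS]ger0_norm ?addr_ge0 ?mulr_ge0 ?(ltW m0) ?(ltW y0)//.
rewrite -[leLHS]sqrtr_sqr ler_wsqrtr//.
rewrite -(real_normK (num_real u)) -(real_normK (num_real v)).
(* Lagrange's identity for the vectors (|u|, |v|) and (y, m). *)
have := sqr_ge0 (`|u| * m - `|v| * y); lra.
Qed.

(** Supplies the finite half-diagonal that stands for an infinite one. *)
Lemma exists_large_denominator (R : realFieldType) (p q : R) : q < 1 ->
  exists2 m : R, 0 < m & `|p| / m + q < 1.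
Proof.
move=> q1; have c0 : 0 < 1 - q by lra.
have m0 : 0 < `|p| / (1 - q) + 1 by rewrite ltr_wpDl// divr_ge0// ltW.
exists (`|p| / (1 - q) + 1) => //.
rewrite -ltrBrDr ltr_pdivrMr// mulrDr mulr1 mulrCA divff ?gt_eqF//; lra.
Qed.

(** Each of the three cases of the radius provides a finite rhombus that
    contains the point and whose open diagonals lie in [D]. *)
Lemma radius_disc_mem (R : realType) (D : set R[i]) (a rho : R)
    (z : R[i]) :
  convex_region D -> conj_invariant D ->
  (lend D < a%:E)%E -> (a%:E < rend D)%E ->
  `|z - a%:C| <= rho%:C -> (rho%:E < radius D a)%E -> D z.
Proof.
move=> cD jD la ar.
case: z => x v; rewrite normc_def lecR /= subr0 => nz rho_lt.
set u := x - a in nz.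
have rho0 : 0 <= rho by apply: le_trans nz; rewrite sqrtr_ge0.
have u_le : `|u| <= rho.
  by apply: le_trans nz; rewrite -sqrtr_sqr ler_wsqrtr// lerDl sqr_ge0.
have v_le : `|v| <= rho.
  by apply: le_trans nz; rewrite -sqrtr_sqr ler_wsqrtr// lerDr sqr_ge0.
suff [m [y [m0 y0 mle yle uv]]] : exists m y : R,
    [/\ 0 < m, 0 < y, (m%:E <= end_dist D a)%E,
        (y%:E <= boundary_curve D a)%E & `|u| / m + `|v| / y < 1].
  have -> : x = a + u by rewrite /u; ring.
  apply: rhombus_mem uv => //.
    by move=> s; apply: end_dist_mem.
  move=> t ty; apply: vertical_mem => //; apply: lt_le_trans yle.
  by rewrite lte_fin.
have d0 : (0 < end_dist D a)%E.
  rewrite /end_dist lt_min.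
  case: (lend D) la => [l| |] //=; case: (rend D) ar => [r| |] //=;
    rewrite ?lte_fin ?normr_gt0 ?subr_eq0 ?ltry ?ltr0n // => h1 h2;
    by rewrite ?(lt_eqF h1) ?(gt_eqF h2).
have y0 : (0 <= boundary_curve D a)%E.
  by apply: ereal_sup_ubound; exists 0 => //=; apply: real_trace_mem.
move: rho_lt; rewrite /radius.
case: (boundary_curve D a) y0 => [y| |]//= y0; last first.
  (* Unbounded from above: the radius is end_dist, and y is as large as
     needed. *)
  move=> rho_lt.
  have [m rho_m m_le] : exists2 m : R, rho < m & (m%:E <= end_dist D a)%E.
    case: (end_dist D a) rho_lt => [m| |] //= rho_lt.
      by exists m; rewrite ?lexx.
    by exists (rho + 1); rewrite ?leey// ltrDl.
  have m0 : 0 < m by apply: le_lt_trans rho_m.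
  have [|y y1 uv] := @exists_large_denominator _ v (`|u| / m).
    by rewrite ltr_pdivrMr// mul1r; apply: le_lt_trans rho_m.
  by exists m, y; split; rewrite ?leey// addrC.
rewrite lee_fin in y0.
case: ifP => fin.
  (* Finite height and a finite endpoint: the rhombus is the largest one. *)
  have : end_dist D a \is a fin_num.
    rewrite /end_dist; case: (lend D) la fin => [l| |] //=;
      case: (rend D) ar => [r| |] //= _ _ _; rewrite minEle ?leey ?leye_eq //=.
    by case: ifP.
  case: (end_dist D a) d0 => [m| |]//=; rewrite lte_fin => m0 _ rho_lt.
  have y1 : 0 < y.
    (* Otherwise the inradius would vanish. *)
    rewrite lt_def y0 andbT; apply/negP => /eqP yE.
    by move: rho_lt; rewrite yE lte_fin mulr0 mul0r ltNge rho0.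
  rewrite lte_fin in rho_lt.
  exists m, y; split => //; apply: le_lt_trans (rhombus_norm_le _ _ m0 y1) _.
  by rewrite ltr_pdivrMr ?mul1r; apply: le_lt_trans rho_lt.
(* Both endpoints are infinite: the radius is y, and m is as large as
   needed. *)
rewrite lte_fin => rho_lt.
have y1 : 0 < y by apply: le_lt_trans rho_lt.
have [|m m0 uv] := @exists_large_denominator _ u (`|v| / y).
  by rewrite ltr_pdivrMr// mul1r; apply: le_lt_trans rho_lt.
exists m, y; split => //.
rewrite /end_dist; case: (lend D) la fin => [l| |] //=;
  case: (rend D) ar => [r| |] //=.
by rewrite /= minxx leey.
Qed.

Theorem theorem2 (R : realType) (D : set (complex R)) (hD : lmi_region D)
  (n : nat) (A : 'M[R]_n) (hA : diag_dominant D A) : region_stable D A.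
Proof.
case: hD => _ [m [L [M [LT DE]]]] z zA.
have [i nz] := @gershgorin _ _ (complex_mx A) z zA.
have [la ar rA] := hA i.
have cD : convex_region D by rewrite DE; apply: lmi_set_convex.
have jD : conj_invariant D by rewrite DE; apply: lmi_set_conj.
apply: (radius_disc_mem cD jD la ar _ rA).
move: nz; rewrite [complex_mx A i i]mxE rmorph_sum /=.
by under eq_bigr do rewrite mxE normc_def /= expr0n addr0 sqrtr_sqr.
Qed.
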